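(* Let $M$ be a smooth connected manifold with a linear connection $\nabla$ (a connection on $TM$) with torsion $T$ and curvature $\mathfrak{R}$. The following two statements are equivalent: (i) for every $1$-form $\theta\in\bigwedge^1(M)$ and every $W\in\mathfrak{X}(M)$, $d\mathfrak{R}_{\theta,W}=d\Psi_{\theta,W}=\nabla\theta\wedge\mathfrak{R}_W+\mathfrak{R}_\theta\wedge\nabla W$; (ii) for all $X,Y,Z\in\mathfrak{X}(M)$, $$\sum_{\mathrm{cyclic}\ XYZ}(\nabla_X\mathfrak{R})(Y,Z)=\sum_{\mathrm{cyclic}\ XYZ}\mathfrak{R}(X,T(Y,Z))$$ as endomorphisms of $\mathfrak{X}(M)$.
   Context: $\mathfrak{X}(M)$ denotes smooth vector fields on $M$. Torsion and curvature: $T(X,Y)=\nabla_XY-\nabla_YX-[X,Y]$, $\mathfrak{R}(X,Y)Z=\nabla_X\nabla_YZ-\nabla_Y\nabla_XZ-\nabla_{[X,Y]}Z$. Covariant derivatives of tensors are the usual ones: $(\nabla_X\theta)(Y)=X(\theta(Y))-\theta(\nabla_XY)$, $(\nabla_X\mathfrak{R})(Y,Z)W=\nabla_X(\mathfrak{R}(Y,Z)W)-\mathfrak{R}(\nabla_XY,Z)W-\mathfrak{R}(Y,\nabla_XZ)W-\mathfrak{R}(Y,Z)\nabla_XW$. The forms are $\mathfrak{R}_{\theta,W}(X,Y)=\theta(\mathfrak{R}(X,Y)W)$, $\Psi_{\theta,W}(X,Y)=(\nabla_Y\theta)(\nabla_XW)-(\nabla_X\theta)(\nabla_YW)$, $(\nabla\theta\wedge\mathfrak{R}_W)(X,Y,Z)=\sum_{\mathrm{cyclic}\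 XYZ}(\nabla_X\theta)(\mathfrak{R}(Y,Z)W)$, $(\mathfrak{R}_\theta\wedge\nabla W)(X,Y,Z)=\sum_{\mathrm{cyclic}\ XYZ}\theta(\mathfrak{R}(Y,Z)\nabla_XW)$. $\sum_{\mathrm{cyclic}\ XYZ}$ is the sum over the three cyclic permutations of $(X,Y,Z)$. The exterior derivative of a $2$-form $\beta$ is normalized by $d\beta(X,Y,Z)=\sum_{\mathrm{cyclic}\ XYZ}\big(X(\beta(Y,Z))-\beta([X,Y],Z)\big)$. *)

(* Defs.v *)
From HB Require Import structures.
From mathcomp Require Import all_boot all_order all_algebra.
From mathcomp Require Import all_classical all_reals.
From mathcomp Require Import topology normedtype derive.
From mathcomp Require Import ring.

Set Implicit Arguments.
Unset Strict Implicit.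
Unset Printing Implicit Defensive.

Import Order.TTheory GRing.Theory Num.Theory.
Import numFieldNormedType.Exports.

Local Open Scope classical_set_scope.
Local Open Scope ring_scope.

Section SmoothEuclidean.
Context {R : realType} {n : nat}.
Implicit Types (U : set 'rV[R]_n) (f g : 'rV[R]_n -> R).

(* C^k on U, meant for open U: the partial derivatives of order <= k exist and
   are continuous at every point of U. *)
Fixpoint Ck_on (k : nat) U f : Prop :=
  (forall x, U x -> {for x, continuous f}) /\
  if k is k'.+1 then
    forall i : 'I_n, (forall x, U x -> derivable f x (delta_mx 0 i)) /\
      Ck_on k' U (fun x => 'D_(delta_mx 0 i) f x)
  else True.

Definition smooth_on U f := forall k, Ck_on k U f.

Lemma Ck_on_eq k U f g : open U -> (forall x, U x -> f x = g x) ->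
  Ck_on k U f -> Ck_on k U g.
Proof.
move=> oU; elim: k f g => [|k IH] f g fg /= [cf Hf].
all: have nfg x : U x -> \forall y \near x, f y = g y
  by move=> Ux; apply: filterS (open_nbhs_nbhs (conj oU Ux)) => y; exact: fg.
all: have cg x : U x -> {for x, continuous g}.
1,3: move=> Ux; have := cf x Ux; rewrite /prop_for /continuous_at -fg// => ?.
1,2: by apply: cvg_trans; first exact: (near_eq_cvg (nfg x Ux)).
all: split=> //.
move=> i; have [df Df] := Hf i; split.
  by move=> x Ux; apply: near_eq_derivable (df x Ux); exact: nfg.
apply: IH Df => x Ux; apply: near_eq_derive; exact: nfg.
Qed.

Lemma Ck_onW k U f : Ck_on k.+1 U f -> Ck_on k U f.
Proof.
elim: k f => [|k IH] f [cf Hf]; first by split.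
by split=> // i; have [df Df] := Hf i; split => //; exact: IH.
Qed.

Lemma Ck_on_cst k U (a : R) : open U -> Ck_on k U (cst a).
Proof.
move=> oU; elim: k a => [|k IH] a; split=> //; try by move=> x _; exact: cst_continuous.
move=> i; split; first by move=> x _; exact: derivable_cst.
by apply: Ck_on_eq (IH 0) => // x _; rewrite derive_cst.
Qed.

Lemma Ck_on_add k U f g : open U -> Ck_on k U f -> Ck_on k U g ->
  Ck_on k U (f + g).
Proof.
move=> oU; elim: k f g => [|k IH] f g [cf Hf] [cg Hg]; split=> //;
  try by move=> x Ux; apply: continuousD; [exact: cf|exact: cg].
move=> i; have [df Df] := Hf i; have [dg Dg] := Hg i; split.
  by move=> x Ux; apply: derivableD; [exact: df|exact: dg].
by apply: Ck_on_eq (IH _ _ Df Dg) => // x Ux; rewrite deriveD//; auto.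
Qed.

Lemma Ck_on_mul k U f g : open U -> Ck_on k U f -> Ck_on k U g ->
  Ck_on k U (f * g).
Proof.
move=> oU; elim: k f g => [|k IH] f g fk gk.
  by case: fk gk => [cf _] [cg _]; split=> // x Ux; apply: continuousM; auto.
have [cf Hf] := fk; have [cg Hg] := gk.
split; first by move=> x Ux; apply: continuousM; auto.
move=> i; have [df Df] := Hf i; have [dg Dg] := Hg i; split.
  by move=> x Ux; apply: derivableM; auto.
have := Ck_on_add oU (IH _ _ (Ck_onW fk) Dg) (IH _ _ (Ck_onW gk) Df).
by apply: Ck_on_eq => // x Ux; rewrite deriveM//; auto.
Qed.

End SmoothEuclidean.

Record chart (R : realType) (n : nat) (M : topologicalType) := Chart {
  chart_dom : set M;
  chart_map : M -> 'rV[R]_n;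
  chart_inv : 'rV[R]_n -> M;
  chart_dom_open : open chart_dom;
  chart_cod_open : open (chart_map @` chart_dom);
  chart_mapK : {in chart_dom, cancel chart_map chart_inv};
  chart_map_continuous : {within chart_dom, continuous chart_map};
  chart_inv_continuous :
    {within chart_map @` chart_dom, continuous chart_inv} }.

Arguments chart_dom_open {R n M} c.
Arguments chart_cod_open {R n M} c.

(* The smooth structure is given by an atlas, not necessarily maximal. *)
Record smoothManifold (R : realType) (n : nat) := SmoothManifold {
  carrier :> topologicalType;
  manifold_hausdorff : hausdorff_space carrier;
  manifold_second_countable : @second_countable carrier;
  atlas : set (chart R n carrier);
  atlas_cover : forall p, exists2 c, atlas c & chart_dom c p;
  atlas_compatible : forall c d, atlas c -> atlas d -> forall i : 'I_n,
    smooth_on (chart_map c @` (chart_dom c `&` chart_dom d))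
      (fun x => chart_map d (chart_inv c x) 0 i) }.

Section SmoothFunctions.
Context {R : realType} {n : nat} (M : smoothManifold R n).

Definition smooth_fun : {pred M -> R} := fun f => `[< forall c, atlas c ->
  smooth_on (chart_map c @` chart_dom c) (f \o chart_inv c) >].

Fact smooth_fun_subring : subring_closed smooth_fun.
Proof.
have cstP a : (cst a : M -> R) \in smooth_fun.
  by apply/asboolP => c _ k; exact: Ck_on_cst (chart_cod_open c).
have mulP f g : f \in smooth_fun -> g \in smooth_fun -> f * g \in smooth_fun.
  move=> /asboolP fs /asboolP gs; apply/asboolP => c cA k.
  by apply: Ck_on_mul (chart_cod_open c) _ _; [exact: fs|exact: gs].
split=> [|f g fs gs|//]; first exact: cstP.
have := mulP _ _ (cstP (-1)) gs; move: fs => /asboolP fs /asboolP gs'.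
apply/asboolP => c cA k.
have := Ck_on_add (chart_cod_open c) (fs c cA k) (gs' c cA k).
apply: Ck_on_eq (chart_cod_open c) _ => x _.
by rewrite [LHS]/= /GRing.add/= /GRing.mul/= mulN1r.
Qed.

Fact smooth_fun_scale (a : R) (f : M -> R) :
  f \in smooth_fun -> a *: f \in smooth_fun.
Proof.
move=> /asboolP fs; apply/asboolP => c cA k.
exact: Ck_on_mul (chart_cod_open c) (Ck_on_cst k a (chart_cod_open c)) (fs c cA k).
Qed.

End SmoothFunctions.
Arguments smooth_fun {R n} M.

(* The algebra C^oo(M) *)
Record Coo (R : realType) (n : nat) (M : smoothManifold R n) := MkCoo {
  Coo_val :> M -> R;
  Coo_valP : Coo_val \in smooth_fun M }.

Section CooAlgebra.
Context {R : realType} {n : nat} (M : smoothManifold R n).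

HB.instance Definition _ := [isSub for @Coo_val R n M].
HB.instance Definition _ := [Choice of Coo M by <:].
HB.instance Definition _ := 
  GRing.SubChoice_isSubComPzRing.Build _ _ (Coo M) (smooth_fun_subring M).

Fact smooth_fun_submod : subsemimod_closed (smooth_fun M).
Proof.
have [_ smB _] := smooth_fun_subring M.
have sm0 : 0 \in smooth_fun M.
  by rewrite -(subrr (1 : M -> R)); apply: smB; case: (smooth_fun_subring M).
split; last exact: smooth_fun_scale.
split=> // f g fs gs; rewrite -(opprK g); apply: (smB) => //.
by rewrite -sub0r; exact: smB.
Qed.

HB.instance Definition _ :=
  GRing.SubZmodule_isSubLmodule.Build _ _ _ (Coo M) smooth_fun_submod.

Lemma Coo_eqP (f g : Coo M) : (forall p, f p = g p) -> f = g.
Proof. by move=> fg; apply: val_inj; exact: funext. Qed.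

End CooAlgebra.

Section Tangent.
Context {R : realType} {n : nat} (M : smoothManifold R n).

(* T_pM: the derivations of C^oo(M) at p *)
Definition derivation_at (p : M) : {pred Coo M -> R} := fun v =>
  `[< scalar v /\ forall f g : Coo M, v (f * g) = f p * v g + g p * v f >].

Fact derivation_at_submod p : submod_closed (derivation_at p).
Proof.
split.
  apply/asboolP; split=> [a f g|f g] /=; rewrite /GRing.zero/=; by rewrite !mulr0 addr0.
move=> a u v /asboolP[ul uM] /asboolP[vl vM]; apply/asboolP.
have E h : (a *: u + v) h = a * u h + v h by [].
by split=> [b f g|f g]; rewrite !E ?ul ?vl ?uM ?vM; ring.
Qed.

End Tangent.

Record tangent (R : realType) (n : nat) (M : smoothManifold R n) (p : M) :=
  MkTangent {
    tangent_val :> Coo M -> R;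
    tangent_valP : tangent_val \in derivation_at p }.

Section TangentSpace.
Context {R : realType} {n : nat} (M : smoothManifold R n) (p : M).

HB.instance Definition _ := [isSub for @tangent_val R n M p].
HB.instance Definition _ := [Choice of tangent p by <:].

Fact derivation_at_subsemimod : subsemimod_closed (derivation_at p).
Proof.
have [d0 dZD] := derivation_at_submod p.
split; last by move=> a v dv; rewrite -[a *: v]addr0; exact: dZD.
by split=> // u v du dv; rewrite -[u]scale1r; exact: dZD.
Qed.

HB.instance Definition _ :=
  GRing.SubChoice_isSubLmodule.Build _ _ _ (tangent p) derivation_at_subsemimod.

Lemma tangent_eqP (u v : tangent p) : (forall f, u f = v f) -> u = v.
Proof. by move=> uv; apply: val_inj; exact: funext. Qed.

Lemma tangent_scalar (v : tangent p) : scalar v.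
Proof. by have /asboolP[] := tangent_valP v. Qed.

Lemma tangent_leibniz (v : tangent p) (f g : Coo M) :
  v (f * g) = f p * v g + g p * v f.
Proof. by have /asboolP[_] := tangent_valP v; apply. Qed.

Lemma tangentD (v : tangent p) f g : v (f + g) = v f + v g.
Proof. by have := tangent_scalar v 1 f g; rewrite scale1r mul1r. Qed.

Lemma tangentB (v : tangent p) f g : v (f - g) = v f - v g.
Proof.
have := tangent_scalar v (-1) g f.
by rewrite scaleN1r mulN1r ![- _ + _]addrC.
Qed.

Lemma tangentZ (v : tangent p) a f : v (a *: f) = a * v f.
Proof.
have v0 : v 0 = 0 by rewrite -(subrr (0 : Coo M)) tangentB subrr.
by have := tangent_scalar v a f 0; rewrite v0 !addr0.
Qed.

End TangentSpace.

(* Sections of TM; smoothness is required as X(f) smooth for every smooth f on M,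
   which is equivalent to smoothness of the components in every chart. *)
Record vecField (R : realType) (n : nat) (M : smoothManifold R n) := MkVecField {
  vf_at :> forall p : M, tangent p;
  vf_smooth : forall f : Coo M, (fun p => vf_at p f) \in smooth_fun M }.

Section VectorFields.
Context {R : realType} {n : nat} (M : smoothManifold R n).
Implicit Types (X Y Z : vecField M) (f g : Coo M).

HB.instance Definition _ := gen_eqMixin (vecField M).
HB.instance Definition _ := gen_choiceMixin (vecField M).

(* The derivative X(f) of f along X *)
Definition vf_app X f : Coo M := MkCoo (vf_smooth X f).

Lemma vf_eqP X Y : (forall p, X p = Y p) -> X = Y.
Proof.
case: X Y => [X sX] [Y sY] /= XY.
have {}XY : X = Y by exact: functional_extensionality_dep.
by subst Y; congr MkVecField; exact: Prop_irrelevance.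
Qed.

Fact vf_zero_smooth f : (fun p => (0 : tangent p) f) \in smooth_fun M.
Proof. exact: Coo_valP (0 : Coo M). Qed.
Fact vf_add_smooth X Y f : (fun p => (X p + Y p) f) \in smooth_fun M.
Proof. exact: Coo_valP (vf_app X f + vf_app Y f). Qed.
Fact vf_opp_smooth X f : (fun p => (- X p) f) \in smooth_fun M.
Proof. exact: Coo_valP (- vf_app X f). Qed.
Fact vf_scale_smooth g X f : (fun p => (g p *: X p) f) \in smooth_fun M.
Proof. exact: Coo_valP (g * vf_app X f). Qed.

Definition vf_zero : vecField M := MkVecField vf_zero_smooth.
Definition vf_add X Y : vecField M := MkVecField (vf_add_smooth X Y).
Definition vf_opp X : vecField M := MkVecField (vf_opp_smooth X).
Definition vf_scale g X : vecField M := MkVecField (vf_scale_smooth g X).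

Fact vf_addA : associative vf_add.
Proof. by move=> X Y Z; apply: vf_eqP => p; exact: addrA. Qed.
Fact vf_addC : commutative vf_add.
Proof. by move=> X Y; apply: vf_eqP => p; exact: addrC. Qed.
Fact vf_add0 : left_id vf_zero vf_add.
Proof. by move=> X; apply: vf_eqP => p; exact: add0r. Qed.
Fact vf_addN : left_inverse vf_zero vf_opp vf_add.
Proof. by move=> X; apply: vf_eqP => p; exact: addNr. Qed.
HB.instance Definition _ :=
  GRing.isZmodule.Build (vecField M) vf_addA vf_addC vf_add0 vf_addN.

Fact vf_scaleA f g X : vf_scale f (vf_scale g X) = vf_scale (f * g) X.
Proof. by apply: vf_eqP => p; exact: scalerA. Qed.
Fact vf_scale1 : left_id 1 vf_scale.
Proof. by move=> X; apply: vf_eqP => p; exact: scale1r. Qed.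
Fact vf_scaleDr : right_distributive vf_scale +%R.
Proof. by move=> f X Y; apply: vf_eqP => p; exact: scalerDr. Qed.
Fact vf_scaleDl X : {morph vf_scale^~ X : f g / f + g}.
Proof. by move=> f g; apply: vf_eqP => p; exact: scalerDl. Qed.
HB.instance Definition _ := GRing.Zmodule_isLmodule.Build (Coo M) (vecField M)
  vf_scaleA vf_scale1 vf_scaleDr vf_scaleDl.

Fact bracket_derivation X Y p :
  (fun f => X p (vf_app Y f) - Y p (vf_app X f)) \in derivation_at p.
Proof.
have appl Z a f g : vf_app Z (a *: f + g) = a *: vf_app Z f + vf_app Z g.
  by apply: Coo_eqP => q; exact: tangent_scalar.
have appM Z f g : vf_app Z (f * g) = f * vf_app Z g + g * vf_app Z f.
  by apply: Coo_eqP => q; exact: tangent_leibniz.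
apply/asboolP; split=> [a f g|f g].
  by rewrite !appl !tangentD !tangentZ; ring.
rewrite !appM !tangentD !tangent_leibniz /=; ring.
Qed.

Definition bracket_at X Y p : tangent p := MkTangent (bracket_derivation X Y p).

Fact bracket_smooth X Y f : (fun p => bracket_at X Y p f) \in smooth_fun M.
Proof. exact: Coo_valP (vf_app X (vf_app Y f) - vf_app Y (vf_app X f)). Qed.

(* The Lie bracket [X, Y] *)
Definition bracket X Y : vecField M := MkVecField (bracket_smooth X Y).

End VectorFields.

(* Sections of T^*M; smoothness is required as theta(X) smooth for every smooth
   vector field X, equivalent to smoothness of the components in every chart. *)
Record oneForm (R : realType) (n : nat) (M : smoothManifold R n) := MkOneForm {
  form_at : forall p : M, {scalar tangent p};
  form_smooth : forall X : vecField M,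
    (fun p => form_at p (X p)) \in smooth_fun M }.

Definition form_app (R : realType) (n : nat) (M : smoothManifold R n)
  (theta : oneForm M) (X : vecField M) : Coo M := MkCoo (form_smooth theta X).
Coercion form_app : oneForm >-> Funclass.

(* A linear connection; nabla X Y is the covariant derivative of Y along X. *)
Record connection (R : realType) (n : nat) (M : smoothManifold R n) :=
  MkConnection {
    nabla :> vecField M -> vecField M -> vecField M;
    nabla_linear : forall (f : Coo M) (X Y Z : vecField M),
      nabla (f *: X + Y) Z = f *: nabla X Z + nabla Y Z;
    nabla_additive : forall X Y Z : vecField M,
      nabla X (Y + Z) = nabla X Y + nabla X Z;
    nabla_leibniz : forall (f : Coo M) (X Y : vecField M),
      nabla X (f *: Y) = vf_app X f *: Y + f *: nabla X Y }.

Section Connection.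
Context {R : realType} {n : nat} {M : smoothManifold R n}.
Variable nabla : connection M.
Implicit Types (X Y Z W : vecField M) (theta : oneForm M).

Definition cyclic_sum (V : zmodType)
    (F : vecField M -> vecField M -> vecField M -> V) X Y Z : V :=
  F X Y Z + F Y Z X + F Z X Y.

Definition torsion X Y := nabla X Y - nabla Y X - bracket X Y.

Definition curvature X Y Z :=
  nabla X (nabla Y Z) - nabla Y (nabla X Z) - nabla (bracket X Y) Z.

Definition nabla_form X theta Y : Coo M :=
  vf_app X (theta Y) - theta (nabla X Y).

Definition nabla_curvature X Y Z W :=
  nabla X (curvature Y Z W) - curvature (nabla X Y) Z W
    - curvature Y (nabla X Z) W - curvature Y Z (nabla X W).

(* Normalized without the factor 1/3. *)
Definition ext_deriv2 (beta : vecField M -> vecField M -> Coo M) :=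
  cyclic_sum (fun X Y Z => vf_app X (beta Y Z) - beta (bracket X Y) Z).

Definition curvature_form theta W X Y : Coo M := theta (curvature X Y W).

Definition Psi_form theta W X Y : Coo M :=
  nabla_form Y theta (nabla X W) - nabla_form X theta (nabla Y W).

Definition nabla_form_wedge_curvature theta W :=
  cyclic_sum (fun X Y Z => nabla_form X theta (curvature Y Z W)).

Definition curvature_wedge_nabla theta W :=
  cyclic_sum (fun X Y Z => theta (curvature Y Z (nabla X W))).

End Connection.

(* Main.v *)
(* With alpha Y = theta (nabla_Y W) one has Psi = curvature form - d alpha, so d d = 0
   makes the first equality of (i) hold unconditionally.  Expanding the covariant
   derivatives, d (curvature form) differs from the right-hand side of (i) by theta
   applied to the difference of the two sides of (ii).  The exact forms theta = df
   already separate vector fields, because tangent vectors are derivations. *)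
From HB Require Import structures.
Require Import Defs.
From mathcomp Require Import all_boot all_order all_algebra.
From mathcomp Require Import all_classical all_reals.
From mathcomp Require Import topology normedtype derive.
From mathcomp Require Import ring.

Set Implicit Arguments.
Unset Strict Implicit.
Unset Printing Implicit Defensive.

Import GRing.Theory.
Local Open Scope classical_set_scope.
Local Open Scope ring_scope.

Section VectorFieldsAndForms.
Context {R : realType} {n : nat} {M : smoothManifold R n}.
Implicit Types (X Y Z : vecField M) (f g : Coo M) (theta : oneForm M).

Lemma vf_appB X f g : vf_app X (f - g) = vf_app X f - vf_app X g.
Proof. by apply: Coo_eqP => p; exact: tangentB. Qed.

Lemma vf_app_bracket X Y f :
  vf_app (bracket X Y) f = vf_app X (vf_app Y f) - vf_app Y (vf_app X f).
Proof. exact: Coo_eqP. Qed.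

(** A tangent vector is a derivation, so its values on functions determine it. Bracket identities
    thus become ring identities in [Coo M] between iterated derivatives. *)
Lemma vf_app_inj X Y : (forall f, vf_app X f = vf_app Y f) -> X = Y.
Proof.
move=> XY; apply: vf_eqP => p; apply: tangent_eqP => f.
by have /(congr1 (fun g : Coo M => g p)) := XY f.
Qed.

Lemma form_appB theta X Y : theta (X - Y) = theta X - theta Y.
Proof. by apply: Coo_eqP => p; exact: (raddfB (form_at theta p)). Qed.

Lemma form_appD theta X Y : theta (X + Y) = theta X + theta Y.
Proof. by apply: Coo_eqP => p; exact: (raddfD (form_at theta p)). Qed.

Lemma form_appN theta X : theta (- X) = - theta X.
Proof. by apply: Coo_eqP => p; exact: (raddfN (form_at theta p)). Qed.

Lemma vf_appDl X Y f : vf_app (X + Y) f = vf_app X f + vf_app Y f.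
Proof. exact: Coo_eqP. Qed.

Lemma vf_appNl X f : vf_app (- X) f = - vf_app X f.
Proof. exact: Coo_eqP. Qed.

Lemma vf_app0l f : vf_app 0 f = 0.
Proof. exact: Coo_eqP. Qed.

Lemma bracketBl X Y Z : bracket (X - Y) Z = bracket X Z - bracket Y Z.
Proof.
apply: vf_app_inj => f.
by rewrite !(vf_appDl, vf_appNl, vf_app_bracket) vf_appB; ring.
Qed.

Lemma bracketC X Y : bracket X Y = - bracket Y X.
Proof. by apply: vf_app_inj => f; rewrite vf_appNl !vf_app_bracket; ring. Qed.

Lemma bracket_jacobi X Y Z :
  bracket (bracket X Y) Z + bracket (bracket Y Z) X + bracket (bracket Z X) Y = 0.
Proof.
apply: vf_app_inj => f.
by rewrite vf_app0l !(vf_appDl, vf_app_bracket, vf_appB); ring.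
Qed.

Definition differential_at f p (v : tangent p) : R := v f.

Fact differential_at_scalar f p : scalar (@differential_at f p).
Proof. by []. Qed.

HB.instance Definition _ f p :=
  GRing.isLinear.Build R (tangent p) R *%R (@differential_at f p)
    (@differential_at_scalar f p).

(** Smoothness of df(X) = X(f) is exactly the condition that [vecField] imposes on X. *)
Definition differential f : oneForm M :=
  @MkOneForm R n M (fun p => @differential_at f p) (fun X => vf_smooth X f).

Lemma differentialE f X : differential f X = vf_app X f.
Proof. exact: Coo_eqP. Qed.

Lemma form_app_inj X Y : (forall theta, theta X = theta Y) -> X = Y.
Proof. by move=> XY; apply: vf_app_inj => f; rewrite -!differentialE XY. Qed.

(** Taking a bare map [alpha] lets Y -> theta(nabla_Y W) be inserted without packaging it as a
    [oneForm]. *)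
Definition ext_deriv1 (alpha : vecField M -> Coo M) X Y :=
  vf_app X (alpha Y) - vf_app Y (alpha X) - alpha (bracket X Y).

Lemma ext_deriv2B (beta gamma : vecField M -> vecField M -> Coo M) :
  ext_deriv2 (fun X Y => beta X Y - gamma X Y)
  = fun X Y Z => ext_deriv2 beta X Y Z - ext_deriv2 gamma X Y Z.
Proof.
apply: funext => X; apply: funext => Y; apply: funext => Z.
by rewrite /ext_deriv2 /cyclic_sum !vf_appB; ring.
Qed.

(** The iterated derivatives cancel because [X,Y] acts as a commutator; additivity collects the
    remaining terms into [alpha] of the Jacobi sum. *)
Lemma ext_deriv2_ext_deriv1 (alpha : vecField M -> Coo M) :
  {morph alpha : X Y / X + Y} -> ext_deriv2 (ext_deriv1 alpha) = 0.
Proof.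
move=> alphaD; apply: funext => X; apply: funext => Y; apply: funext => Z.
have alpha0 : alpha 0 = 0.
  by have /esym/eqP := alphaD 0 0; rewrite addr0 -subr_eq0 addrK => /eqP.
have /(congr1 alpha) := bracket_jacobi X Y Z; rewrite !alphaD alpha0 => jacobi.
rewrite /ext_deriv2 /cyclic_sum /ext_deriv1 !vf_appB !vf_app_bracket -[RHS]jacobi.
ring.
Qed.

End VectorFieldsAndForms.

Section Connection.
Context {R : realType} {n : nat} {M : smoothManifold R n}.
Variable nabla : connection M.
Implicit Types (X Y Z W : vecField M) (theta : oneForm M).

Lemma nablaDl X Y Z : nabla (X + Y) Z = nabla X Z + nabla Y Z.
Proof. by rewrite -[X in nabla (X + _)]scale1r nabla_linear scale1r. Qed.

Lemma nablaNl X Z : nabla (- X) Z = - nabla X Z.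
Proof.
apply: (addrI (nabla X Z)); rewrite -nablaDl !subrr.
by apply: (addrI (nabla 0 Z)); rewrite -nablaDl !addr0.
Qed.

Lemma nablaBr X Y Z : nabla X (Y - Z) = nabla X Y - nabla X Z.
Proof. by apply/esym/eqP; rewrite subr_eq -nabla_additive subrK. Qed.

Lemma curvatureC X Y W : curvature nabla X Y W = - curvature nabla Y X W.
Proof.
by rewrite /curvature (bracketC X) nablaNl opprK !opprD !opprK (addrC (- _)).
Qed.

Lemma curvatureBl X Y Z W :
  curvature nabla (X - Y) Z W = curvature nabla X Z W - curvature nabla Y Z W.
Proof.
(* Testing against 1-forms moves the identity from the module of vector fields to the commutative
   ring [Coo M]. *)
apply: form_app_inj => theta.
by rewrite /curvature bracketBl !(nablaDl, nablaNl) nablaBr !(form_appB, form_appD); ring.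
Qed.

(** The second covariant derivatives in Psi are those of the curvature; the term theta(nabla_[X,Y]
    W) of the curvature is cancelled by the bracket term of d alpha. *)
Lemma Psi_formE theta W :
  Psi_form nabla theta W = fun X Y =>
    curvature_form nabla theta W X Y
    - ext_deriv1 (fun Z => theta (nabla Z W)) X Y.
Proof.
apply: funext => X; apply: funext => Y.
rewrite /Psi_form /curvature_form /ext_deriv1 /nabla_form /curvature !form_appB; ring.
Qed.

Lemma ext_deriv2_Psi_form theta W :
  ext_deriv2 (Psi_form nabla theta W) = ext_deriv2 (curvature_form nabla theta W).
Proof.
rewrite Psi_formE ext_deriv2B ext_deriv2_ext_deriv1; last first.
  by move=> X Y /=; rewrite nablaDl form_appD.
by apply: funext => X; apply: funext => Y; apply: funext => Z; exact: subr0.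
Qed.

(** Split X(theta(R(Y,Z)W)) by the Leibniz rule for nabla theta and nabla R. The leftover terms
    R(nabla_X Y, Z), R(Y, nabla_X Z) and R([X,Y], Z) assemble cyclically into the torsion sum. *)
Lemma ext_deriv2_curvature_form theta W X Y Z :
  ext_deriv2 (curvature_form nabla theta W) X Y Z =
    nabla_form_wedge_curvature nabla theta W X Y Z
    + curvature_wedge_nabla nabla theta W X Y Z
    + (theta (cyclic_sum (fun X Y Z => nabla_curvature nabla X Y Z
                   : vecField M -> vecField M) X Y Z W)
       - theta (cyclic_sum (fun X Y Z => curvature nabla X (torsion nabla Y Z)
                   : vecField M -> vecField M) X Y Z W)).
Proof.
have cyc (F : vecField M -> vecField M -> vecField M -> vecField M -> vecField M) :
    theta (cyclic_sum F X Y Z W)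
    = theta (F X Y Z W) + theta (F Y Z X W) + theta (F Z X Y W).
  by rewrite -!form_appD.
rewrite !cyc /ext_deriv2 /nabla_form_wedge_curvature /curvature_wedge_nabla /cyclic_sum.
rewrite /curvature_form /nabla_form /nabla_curvature.
(* Antisymmetry puts every torsion, and below every covariant derivative, into the first slot of the
   curvature, so that equal terms match syntactically. *)
rewrite !(curvatureC _ (torsion nabla _ _)) /torsion !curvatureBl.
rewrite (curvatureC Y (nabla X Z)) (curvatureC Z (nabla Y X)) (curvatureC X (nabla Z Y)).
rewrite !(form_appB, form_appD, form_appN); ring.
Qed.

End Connection.

Theorem proposition3p3 (R : realType) (n : nat) (M : smoothManifold R n)
    (connectedM : connected [set: M]) (nabla : connection M) :
  (forall (theta : oneForm M) (W : vecField M),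
     ext_deriv2 (curvature_form nabla theta W)
       = ext_deriv2 (Psi_form nabla theta W)
     /\ ext_deriv2 (Psi_form nabla theta W)
       = nabla_form_wedge_curvature nabla theta W
         + curvature_wedge_nabla nabla theta W)
  <->
  (forall X Y Z : vecField M,
     cyclic_sum (fun X Y Z => nabla_curvature nabla X Y Z
                   : vecField M -> vecField M) X Y Z
     = cyclic_sum (fun X Y Z => curvature nabla X (torsion nabla Y Z)
                   : vecField M -> vecField M) X Y Z).
Proof.
split=> [dR X Y Z|bianchi theta W].
  apply: funext => W; apply: form_app_inj => theta; apply/eqP.
  have [dRPsi dPsi] := dR theta W.
  have := ext_deriv2_curvature_form nabla theta W X Y Z.
  (* Under (i) the wedge terms occur on both sides; cancelling them leaves equality of [theta] on
     the two cyclic sums. *)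
  rewrite dRPsi dPsi => /eqP.
  by rewrite -subr_eq0 opprD addrA subrr sub0r oppr_eq0 subr_eq0.
rewrite ext_deriv2_Psi_form; split=> //.
apply: funext => X; apply: funext => Y; apply: funext => Z.
by rewrite ext_deriv2_curvature_form bianchi subrr addr0.
Qed.
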